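(* Let $G=(V,E)$ be a finite connected simple graph with edge lengths $d\colon E\to(0,\infty)$ such that $d$ satisfies the Treelike property, and let $F\colon(0,\infty)\to(0,\infty)$ be an increasing function. Equip $G$ with the weight distribution $w_e=\frac{F(d(e))}{d(e)}$ for each edge $e\in E$. Then the total curvature satisfies $$K(G)\leq 2|V|-2|E|,$$ with equality if and only if $d$ is a constant function.
   Context: A weighted graph $G=(V,E,d)$ is a connected simple graph with a length function $d\colon E\to(0,\infty)$. For arbitrary vertices $x,y$, $d(x,y)$ denotes the minimum total length of a path joining $x$ and $y$; it is assumed that for every edge $xy$ this shortest-path distance equals the length of the edge $xy$. $\Gamma(x)$ is the set of neighbors of $x$, and $N(x)=\Gamma(x)\cup\{x\}$. A weight distribution is a function $w\colon E\to(0,\infty)$, written $w_{xy}=w_{yx}$; set $D_x=\sum_{y\sim x}w_{xy}$. For $\alpha\in[0,1]$ and $x\in V$ define the probability measure $\mu_x^\alpha$ by $\mu_x^\alpha(x)=\alpha$, $\mu_x^\alpha(z)=(1-\alpha)\frac{w_{xz}}{D_x}$ if $z\sim x$, and $\mu_x^\alpha(z)=0$ otherwise. A coupling between probability measures $\mu_1,\mu_2$ on $V$ is a finitely supported $A\colon V\times V\to[0,1]$ with $\sum_y A(x,y)=\mu_1(x)$ and $\sum_x A(x,y)=\mu_2(y)$; the transportation distance is $W(\mu_1,\mu_2)=\inf_A\sum_{x,y}A(x,y)d(x,y)$ over all couplings. For vertices $x\neq y$: $\kappa_\alpha(x,y)=1-\frac{W(\mu_x^\alpha,\mu_y^\alpha)}{d(x,y)}$,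 and $\kappa(x,y)=\lim_{\alpha\to1}\frac{\kappa_\alpha(x,y)}{1-\alpha}$. The total curvature is $K(G)=\sum_{xy\in E}\kappa(x,y)$. The distance $d$ satisfies the Treelike property if for every edge $xy\in E$ and all $k\in N(x)\setminus\{y\}$, $l\in N(y)\setminus\{x\}$ one has $d(k,l)=d(k,x)+d(x,y)+d(y,l)$.
   Formalization: The equality characterization is stated for graphs with at least two vertices, since for a single vertex K = 0 < 2 although d is vacuously constant; ''increasing'' is read as strictly increasing. *)

(* Defs.v *)
From mathcomp Require Import all_boot all_order all_algebra.
From mathcomp Require Import all_classical all_reals all_analysis.

Set Implicit Arguments.
Unset Strict Implicit.
Unset Printing Implicit Defensive.

Import Order.TTheory GRing.Theory Num.Theory.
Import numFieldNormedType.Exports.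

Local Open Scope ring_scope.

Definition path_length (R : realType) (V : finType) (len : V -> V -> R)
    (x : V) (p : seq V) : R :=
  \sum_(t <- pairmap len x p) t.

(* The set of simple paths from x to y is finite, and nonempty in a connected
   graph, so this infimum is a minimum. *)
Definition path_dist (R : realType) (V : finType) (adj : rel V)
    (len : V -> V -> R) (x y : V) : R :=
  inf [set r : R | exists p : seq V,
         [/\ path adj x p, uniq (x :: p), last x p = y
           & r = path_length len x p]]%classic.

(* Edge lengths are given by a function on pairs of vertices; its values on
   non-adjacent pairs are irrelevant. *)
Record weighted_graph (R : realType) := WeightedGraph {
  vertex : finType;
  adj : rel vertex;
  len : vertex -> vertex -> R;
  adj_sym : symmetric adj;
  adj_irr : irreflexive adj;
  adj_connected : forall x y : vertex, connect adj x y;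
  len_sym : forall x y : vertex, adj x y -> len x y = len y x;
  len_gt0 : forall x y : vertex, adj x y -> 0 < len x y;
  len_dist : forall x y : vertex, adj x y -> path_dist adj len x y = len x y
}.

Definition dist (R : realType) (G : weighted_graph R) (x y : vertex G) : R :=
  path_dist (@adj R G) (@len R G) x y.

(* Each undirected edge is listed once, oriented along the enumeration of the
   vertices. *)
Definition edges (R : realType) (G : weighted_graph R) :
    {set vertex G * vertex G} :=
  finset (fun p : vertex G * vertex G =>
    adj p.1 p.2 && (enum_rank p.1 < enum_rank p.2)%N).

Definition closed_nbhd (R : realType) (G : weighted_graph R) (x : vertex G) :
    {set vertex G} :=
  finset (fun z : vertex G => adj x z || (z == x)).

Definition treelike (R : realType) (G : weighted_graph R) : Prop :=
  forall x y : vertex G, adj x y ->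
  forall k l : vertex G, k \in closed_nbhd x :\ y -> l \in closed_nbhd y :\ x ->
  dist k l = dist k x + dist x y + dist y l.

Definition weighted_degree (R : realType) (G : weighted_graph R)
    (w : vertex G -> vertex G -> R) (x : vertex G) : R :=
  \sum_(y | adj x y) w x y.

Definition mu (R : realType) (G : weighted_graph R)
    (w : vertex G -> vertex G -> R) (alpha : R) (x z : vertex G) : R :=
  if z == x then alpha
  else if adj x z then (1 - alpha) * (w x z / weighted_degree w x)
  else 0.

Definition coupling (R : realType) (V : finType) (m1 m2 : V -> R)
    (A : V -> V -> R) : Prop :=
  [/\ forall x y : V, 0 <= A x y <= 1,
      forall x : V, \sum_y A x y = m1 x
    & forall y : V, \sum_x A x y = m2 y].

Definition transport (R : realType) (G : weighted_graph R)
    (m1 m2 : vertex G -> R) : R :=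
  inf [set c : R | exists2 A : vertex G -> vertex G -> R,
         coupling m1 m2 A & c = \sum_x \sum_y A x y * dist x y]%classic.

Definition kappa_alpha (R : realType) (G : weighted_graph R)
    (w : vertex G -> vertex G -> R) (alpha : R) (x y : vertex G) : R :=
  1 - transport (mu w alpha x) (mu w alpha y) / dist x y.

(* As alpha ranges over [0, 1], the limit at 1 is a left limit. *)
Definition kappa (R : realType) (G : weighted_graph R)
    (w : vertex G -> vertex G -> R) (x y : vertex G) : R :=
  lim (kappa_alpha w alpha x y / (1 - alpha) @[alpha --> 1^'-])%classic.

(* kappa is symmetric, so the orientation of the edges does not matter. *)
Definition total_curvature (R : realType) (G : weighted_graph R)
    (w : vertex G -> vertex G -> R) : R :=
  \sum_(p in edges G) kappa w p.1 p.2.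

(* Main.v *)
(* Fix an edge xy and alpha close to 1. Under the Treelike property, the function
   equal to d(x, k) on N(x) \ {y} and to -(d(x, y) + d(y, l)) on N(y) \ {x}
   is an optimal Kantorovich potential between mu_x and mu_y: it is tight for the
   coupling that keeps in place the mass which mu_x and mu_y share at x and y and
   moves the rest by a product coupling. With S_x = sum_(z ~ x) F(d(x, z)), this
   yields
     kappa(x, y) = 2 w_xy (1/D_x + 1/D_y) - (S_x/D_x + S_y/D_y) / d(x, y).
   Summing over edges gives K = 2|V| - sum_x (S_x/D_x) sum_(y ~ x) 1/d(x, y).
   As F and t |-> 1/t are oppositely ordered and w = F(d)/d, Chebyshev's sum
   inequality at x bounds the x-th term below by deg x, with equality exactly when
   the edges at x all have the same length; connectedness makes this global. *)

Require Import Defs.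
From mathcomp Require Import all_boot all_order all_algebra.
From mathcomp Require Import all_classical all_reals all_analysis.
From mathcomp Require Import ring lra.

Import Order.TTheory GRing.Theory Num.Theory.
Import numFieldNormedType.Exports.

Local Open Scope ring_scope.

(** * Distances along edges and positivity of degrees *)

Lemma dist_refl {R : realType} {G : weighted_graph R} (x : vertex G) :
  dist x x = 0.
Proof.
rewrite /dist /path_dist.
rewrite [X in inf X](_ : _ = [set 0]%classic) ?inf1//.
apply/seteqP; split=> [r [p [_ + + ->]]|r ->] /=.
  case: p => [|z p] /=; first by rewrite /path_length big_nil.
  by move=> /andP[+ _] last_x; rewrite -{1}last_x mem_last.
by exists [::]; split=> //; rewrite /path_length big_nil.
Qed.

Lemma dist_adj {R : realType} {G : weighted_graph R} {x y : vertex G} :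
  adj x y -> dist x y = len x y.
Proof. exact: len_dist. Qed.

Lemma adj_neq {R : realType} {G : weighted_graph R} {x y : vertex G} :
  adj x y -> x != y.
Proof. by apply: contraTneq => ->; rewrite adj_irr. Qed.

Lemma dist_closed_nbhd {R : realType} {G : weighted_graph R} {u v : vertex G} :
  v \in closed_nbhd u -> 0 <= dist u v /\ dist u v = dist v u.
Proof.
rewrite inE => /orP[uv|/eqP->]; last by rewrite dist_refl.
have vu : adj v u by rewrite adj_sym.
by rewrite (dist_adj uv) (dist_adj vu) (len_sym uv) ltW ?len_gt0.
Qed.

Lemma weighted_degree_gt0 {R : realType} {G : weighted_graph R}
    {w : vertex G -> vertex G -> R} {x y : vertex G} :
  (forall x y, adj x y -> 0 < w x y) -> adj x y -> 0 < weighted_degree w x.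
Proof.
move=> w_gt0 xy; rewrite /weighted_degree (bigD1 y)//=.
by rewrite ltr_wpDr ?w_gt0// sumr_ge0// => z /andP[/w_gt0/ltW].
Qed.

(** * Averages against [mu], transport duality and couplings *)

Lemma sum_mu {R : realType} {G : weighted_graph R}
    (w : vertex G -> vertex G -> R) (a : R) (x : vertex G) (f : vertex G -> R) :
  \sum_z mu w a x z * f z =
  a * f x + (1 - a) * ((\sum_(z | adj x z) w x z * f z) / weighted_degree w x).
Proof.
rewrite (bigD1 x)//= /mu eqxx; congr +%R.
rewrite mulr_suml mulr_sumr [RHS]big_mkcond/= [LHS]big_mkcond/=.
apply: eq_bigr => z _; have [->|_] := eqVneq z x; first by rewrite adj_irr.
by case: ifP => _ /=; rewrite ?mul0r// -!mulrA [_^-1 * _]mulrC.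
Qed.

(** Weak duality bounds every cost from below, and tightness on the support of [A] makes [A] attain
    the bound. The Lipschitz condition is asked on the supports only, since the potential used later
    is controlled only on N(x) and N(y). *)
Lemma transport_dual {R : realType} {G : weighted_graph R}
    {m1 m2 f : vertex G -> R} {A : vertex G -> vertex G -> R} :
  coupling m1 m2 A ->
  (forall k l, m1 k != 0 -> m2 l != 0 -> f k - f l <= dist k l) ->
  (forall k l, A k l != 0 -> dist k l = f k - f l) ->
  transport m1 m2 = \sum_k m1 k * f k - \sum_k m2 k * f k.
Proof.
move=> cplA f_lip A_tight.
have dualE B : coupling m1 m2 B ->
    \sum_k \sum_l B k l * (f k - f l) = \sum_k m1 k * f k - \sum_k m2 k * f k.
  move=> [_ B1 B2].
  under eq_bigr do (under eq_bigr do rewrite mulrBr; rewrite sumrB).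
  rewrite sumrB; congr (_ - _); last rewrite exchange_big/=.
    by apply: eq_bigr => k _; rewrite -mulr_suml B1.
  by apply: eq_bigr => k _; rewrite -mulr_suml B2.
have supp B k l : coupling m1 m2 B -> B k l != 0 -> m1 k != 0 /\ m2 l != 0.
  move=> [B01 B1 B2] Bkl; have B_ge0 i j : 0 <= B i j by case/andP: (B01 i j).
  split; rewrite -?B1 -?B2 psumr_neq0//; apply/hasP.
    by exists l; rewrite ?mem_index_enum//= lt_def Bkl/=.
  by exists k; rewrite ?mem_index_enum//= lt_def Bkl/=.
rewrite /transport; set S := (X in inf X).
have S_lb : lbound S (\sum_k m1 k * f k - \sum_k m2 k * f k).
  move=> _ [B cplB ->]; rewrite -(dualE B cplB).
  apply: ler_sum => k _; apply: ler_sum => l _.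
  have [->|/supp-/(_ cplB)[m1k m2l]] := eqVneq (B k l) 0; first by rewrite !mul0r.
  by rewrite ler_wpM2l ?f_lip//; case: cplB => + _ _ => /(_ k l)/andP[].
have SA : S (\sum_k m1 k * f k - \sum_k m2 k * f k).
  exists A => //; rewrite -(dualE A cplA).
  apply: eq_bigr => k _; apply: eq_bigr => l _.
  by have [->|/A_tight->] := eqVneq (A k l) 0; first by rewrite !mul0r.
apply/eqP; rewrite eq_le; apply/andP; split.
  by apply: ge_inf => //; exists (\sum_k m1 k * f k - \sum_k m2 k * f k).
by apply: lb_le_inf => //; exists (\sum_k m1 k * f k - \sum_k m2 k * f k).
Qed.

(* The coupling leaves the common part [c] in place and moves the rest by the
   product coupling. *)
Lemma coupling_common_part {R : realType} {V : finType} {m1 m2 c : V -> R} :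
  (forall k, 0 <= c k) -> (forall k, c k <= m1 k) -> (forall k, c k <= m2 k) ->
  \sum_k m1 k = 1 -> \sum_k m2 k = 1 -> \sum_k c k < 1 ->
  coupling m1 m2 (fun k l => (k == l)%:R * c k +
    (m1 k - c k) * (m2 l - c l) / (1 - \sum_k c k)).
Proof.
move=> c_ge0 c_le1 c_le2 m1_sum m2_sum c_sum.
have M_gt0 : 0 < 1 - \sum_k c k by rewrite subr_gt0.
set A := fun k l => _.
have A_ge0 k l : 0 <= A k l.
  by rewrite addr_ge0 ?mulr_ge0 ?invr_ge0 ?subr_ge0// ltW.
have A1 k : \sum_l A k l = m1 k.
  rewrite big_split/= (bigD1 k)//= eqxx mul1r big1 ?addr0; last first.
    by move=> l; rewrite eq_sym => /negPf ->; rewrite mul0r.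
  rewrite -mulr_suml -mulr_sumr sumrB m2_sum mulfK ?gt_eqF//; lra.
have A2 l : \sum_k A k l = m2 l.
  rewrite big_split/= (bigD1 l)//= eqxx mul1r big1 ?addr0; last first.
    by move=> k /negPf ->; rewrite mul0r.
  rewrite -mulr_suml -mulr_suml sumrB m1_sum mulrAC mulfV ?gt_eqF//; lra.
(* An entry is at most its row sum [m1 k], hence at most the total mass 1. *)
split=> // k l; rewrite A_ge0/= -m1_sum (bigD1 k)//= -A1 (bigD1 l)//=.
rewrite -addrA lerDl addr_ge0 ?sumr_ge0// => i _.
exact: le_trans (c_ge0 i) (c_le1 i).
Qed.

(** * Curvature of a single edge *)

Lemma near_left1_half {R : realType} :
  (\forall a \near (1 : R)^'-, 2^-1 < a < 1)%classic.
Proof.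
near=> a; apply/andP; split; last by near: a; exact: nbhs_left_lt.
by near: a; apply: nbhs_left_gt; rewrite invf_lt1 ?ltr1n.
Unshelve. all: by end_near. Qed.

(* The contribution of the endpoint [x] to the curvature of the edge [xy]. *)
Definition half_kappa {R : realType} {G : weighted_graph R}
    (w : vertex G -> vertex G -> R) (x y : vertex G) : R :=
  2 * w x y / weighted_degree w x -
  (\sum_(z | adj x z) w x z * len x z) / weighted_degree w x / len x y.

Section TreelikeEdge.
Context {R : realType} {G : weighted_graph R} (G_treelike : treelike G).
Context (w : vertex G -> vertex G -> R).
Hypothesis w_gt0 : forall x y, adj x y -> 0 < w x y.
Context (x y : vertex G) (xy : adj x y).

(* Kantorovich potential: its difference is [dist k l] for all [k] in [N(x)] and
   [l] in [N(y)] except [(k, l) = (y, x)], a pair an optimal coupling avoids. *)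
Definition edge_potential (z : vertex G) : R :=
  if z \in closed_nbhd x :\ y then dist z x else - (dist x y + dist y z).

Let d_gt0 : 0 < dist x y. Proof. by rewrite dist_adj ?len_gt0. Qed.
Let yx : adj y x. Proof. by rewrite adj_sym. Qed.
Let x_neq_y : x != y. Proof. exact: adj_neq. Qed.
Let dist_yx : dist y x = dist x y.
Proof. by rewrite !dist_adj// len_sym. Qed.

Lemma edge_potential_l z : z \in closed_nbhd x -> z != y ->
  edge_potential z = dist x z.
Proof.
move=> xz zy; rewrite /edge_potential in_setD1 zy xz/=.
by case: (dist_closed_nbhd xz).
Qed.

(** The two branches of the potential do not compete: for a common neighbor [z] of [x] and [y], the
    Treelike property with k = l = z would give 0 = d(z, x) + d(x, y) + d(y, z) > 0. *)
Lemma edge_potential_r z : z \in closed_nbhd y -> z != x ->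
  edge_potential z = - (dist x y + dist y z).
Proof.
move=> yz zx; rewrite /edge_potential; case: ifP => // xz.
have yz' : z \in closed_nbhd y :\ x by rewrite in_setD1 zx.
have := G_treelike _ _ xy _ _ xz yz'; rewrite dist_refl.
have := dist_closed_nbhd yz; have [//|+ <-] := @dist_closed_nbhd R G x z.
  by move: xz; rewrite in_setD1 => /andP[].
by move: d_gt0 => + + [+ _]; lra.
Qed.

Lemma edge_potentialBl k l : k \in closed_nbhd x -> l \in closed_nbhd y ->
  ~~ ((k == y) && (l == x)) -> dist k l = edge_potential k - edge_potential l.
Proof.
move=> xk yl; have yNy : y \in closed_nbhd y by rewrite inE eqxx orbT.
have xNx : x \in closed_nbhd x by rewrite inE eqxx orbT.
have y_neq_x : y != x by rewrite eq_sym.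
have [->/= lx|ky _] := eqVneq k y.
  by rewrite !edge_potential_r// dist_refl; ring.
have [->|lx] := eqVneq l x.
  rewrite !edge_potential_l// dist_refl subr0.
  by have [_ ->] := dist_closed_nbhd xk.
rewrite edge_potential_l// edge_potential_r//.
rewrite (G_treelike _ _ xy) ?in_setD1 ?ky ?lx//.
have [_ ->] := dist_closed_nbhd xk; ring.
Qed.

Lemma edge_potential_lip k l : k \in closed_nbhd x -> l \in closed_nbhd y ->
  edge_potential k - edge_potential l <= dist k l.
Proof.
move=> xk yl; have [/andP[/eqP-> /eqP->]|kl] := boolP ((k == y) && (l == x)).
  (* At the exceptional pair [(y, x)] the difference of potentials is -d(x, y). *)
  rewrite edge_potential_r ?inE ?eqxx ?orbT// 1?eq_sym//.
  rewrite edge_potential_l ?inE ?eqxx ?orbT//.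
  by rewrite !dist_refl dist_yx; move: d_gt0; lra.
by rewrite edge_potentialBl.
Qed.

Let Dx_gt0 : 0 < weighted_degree w x. Proof. exact: weighted_degree_gt0 xy. Qed.
Let Dy_gt0 : 0 < weighted_degree w y. Proof. exact: weighted_degree_gt0 yx. Qed.

Lemma transport_edge (a : R) : 2^-1 < a -> a < 1 ->
  transport (mu w a x) (mu w a y) =
  \sum_z mu w a x z * edge_potential z - \sum_z mu w a y z * edge_potential z.
Proof.
move=> a_gt a_lt1.
have a_gt0 : 0 < a by lra.
have w_le_D u v : adj u v -> 0 <= w u v / weighted_degree w u <= 1.
  move=> uv; have D_gt0 := weighted_degree_gt0 w_gt0 uv.
  apply/andP; split; first by rewrite divr_ge0// ltW// w_gt0.
  rewrite ler_pdivrMr// mul1r /weighted_degree (bigD1 v)//=.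
  by rewrite lerDl sumr_ge0// => z /andP[/w_gt0/ltW].
have mu_ge0 u z : 0 <= mu w a u z.
  rewrite /mu; case: ifP => _; first exact: ltW.
  by case: ifP => // uz; case/andP: (w_le_D _ _ uz) => ? _; rewrite mulr_ge0//; lra.
have mu_adj u v : adj u v -> mu w a u v <= 1 - a.
  move=> uv; rewrite /mu eq_sym (negPf (adj_neq uv)) uv ler_piMr//; first by lra.
  by case/andP: (w_le_D _ _ uv).
have mu_self u : mu w a u u = a by rewrite /mu eqxx.
have mu_sum u : 0 < weighted_degree w u -> \sum_z mu w a u z = 1.
  move=> D_gt0; have := sum_mu w a u (fun=> 1).
  under eq_bigr do rewrite mulr1; move=> ->.
  under eq_bigr do rewrite mulr1; rewrite -/(weighted_degree w u).
  by rewrite divff ?gt_eqF//; ring.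
have supp u z : mu w a u z != 0 -> z \in closed_nbhd u.
  by rewrite inE /mu; case: (z == u); rewrite ?orbT// orbF; case: ifP => //; rewrite eqxx.
(* The mass shared at [x] and [y]: as 1 - a < a, the smaller value at [x] is that of mu_y, and at
   [y] that of mu_x. Its total is at most 2(1 - a) < 1, as the product coupling of the rest
   requires. *)
pose c z := (z == x)%:R * mu w a y x + (z == y)%:R * mu w a x y.
have cE : [/\ c x = mu w a y x, c y = mu w a x y &
    forall z, z != x -> z != y -> c z = 0].
  rewrite /c !eqxx [y == x]eq_sym (negPf x_neq_y) /=; split; try by ring.
  by move=> z /negPf -> /negPf -> /=; ring.
have [cx cy c0] := cE.
have c_le u : u = x \/ u = y -> forall z, c z <= mu w a u z.
  have := mu_adj _ _ xy; have := mu_adj _ _ yx; have := mu_self x; have := mu_self y.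
  move=> muy mux muyx muxy; case=> ->; move=> z;
    have [->|zx] := eqVneq z x; rewrite ?cx //; try lra;
    have [->|zy] := eqVneq z y; rewrite ?cy ?c0//; lra.
have c_ge0 z : 0 <= c z by rewrite addr_ge0// mulr_ge0.
have c_sum : \sum_z c z < 1.
  rewrite (bigD1 x)//= (bigD1 y) 1?eq_sym//= big1 ?addr0; last first.
    by move=> z /andP[? ?]; rewrite c0.
  by rewrite cx cy; have := mu_adj _ _ xy; have := mu_adj _ _ yx; lra.
have cpl := coupling_common_part c_ge0 (c_le x (or_introl erefl))
  (c_le y (or_intror erefl)) (mu_sum x Dx_gt0) (mu_sum y Dy_gt0) c_sum.
apply: (transport_dual cpl) => [k l /supp xk /supp yl|k l].
  exact: edge_potential_lip.
have [-> _|kl] := eqVneq k l; first by rewrite dist_refl subrr.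
rewrite mul0r add0r mulf_eq0 negb_or => /andP[+ _].
rewrite mulf_eq0 negb_or => /andP[k0 l0].
have xk : k \in closed_nbhd x.
  apply: supp; apply: contra_neq k0 => muk.
  by have := c_le x (or_introl erefl) k; have := c_ge0 k; rewrite muk; lra.
have yl : l \in closed_nbhd y.
  apply: supp; apply: contra_neq l0 => mul.
  by have := c_le y (or_intror erefl) l; have := c_ge0 l; rewrite mul; lra.
(* The exceptional pair [(y, x)] carries no mass: [c] already takes all of mu_x at [y]. *)
apply: edge_potentialBl => //; apply/negP => /andP[/eqP ky _].
by move: k0; rewrite ky cy subrr eqxx.
Qed.

Lemma kappa_edge : kappa w x y = half_kappa w x y + half_kappa w y x.
Proof.
have d_neq0 : len x y != 0 by rewrite gt_eqF ?len_gt0.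
(* On the neighbors of an endpoint [u] the potential is affine in the edge length, except at the
   other endpoint [v], where [C] corrects it by twice d(x, y) up to sign. *)
have affine_sum u v (A B C : R) : adj u v -> 0 < weighted_degree w u ->
    (\sum_(z | adj u z) w u z * (A + B * len u z + (z == v)%:R * C))
      / weighted_degree w u =
    A + B * ((\sum_(z | adj u z) w u z * len u z) / weighted_degree w u)
      + C * (w u v / weighted_degree w u).
  move=> uv D_gt0.
  rewrite (eq_bigr (fun z => w u z * A + w u z * len u z * B
    + (z == v)%:R * (w u z * C))); last by move=> z _; ring.
  rewrite !big_split/= -!mulr_suml -/(weighted_degree w u).
  rewrite [X in (_ + X) / _](bigD1 v)//= eqxx mul1r [X in _ + (_ + X)]big1 ?addr0; last first.
    by move=> z /andP[_ /negPf->]; rewrite mul0r.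
  by field; rewrite gt_eqF.
have potx : edge_potential x = 0.
  by rewrite edge_potential_l ?dist_refl// inE eqxx orbT.
have poty : edge_potential y = - len x y.
  by rewrite edge_potential_r ?dist_refl ?inE ?eqxx ?orbT 1?eq_sym// addr0 dist_adj.
have sumx : (\sum_(z | adj x z) w x z * edge_potential z) / weighted_degree w x =
    0 + 1 * ((\sum_(z | adj x z) w x z * len x z) / weighted_degree w x)
      + (- 2 * len x y) * (w x y / weighted_degree w x).
  rewrite -affine_sum//; congr (_ / _); apply: eq_bigr => z xz; congr (_ * _).
  have [->|zy] := eqVneq z y; first by rewrite poty /=; ring.
  by rewrite edge_potential_l ?inE ?xz// dist_adj//=; ring.
have sumy : (\sum_(z | adj y z) w y z * edge_potential z) / weighted_degree w y =
    - len x y + (- 1) * ((\sum_(z | adj y z) w y z * len y z) / weighted_degree w y)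
      + (2 * len x y) * (w y x / weighted_degree w y).
  rewrite -affine_sum//; congr (_ / _); apply: eq_bigr => z yz; congr (_ * _).
  have [->|zx] := eqVneq z x; first by rewrite potx (len_sym yx) /=; ring.
  by rewrite edge_potential_r ?inE ?yz// !dist_adj//=; ring.
(* The quotient is constant for a in (1/2, 1), so the left limit is that constant. *)
apply/cvg_lim => //; apply: cvg_near_cst.
apply: filterS near_left1_half => a /andP[a_gt a_lt1].
rewrite /kappa_alpha transport_edge// !sum_mu potx poty dist_adj// sumx sumy.
rewrite /half_kappa (len_sym yx).
field; rewrite d_neq0 !gt_eqF//= subr_gt0//.
Qed.

End TreelikeEdge.

(** * Double counting of edges and Chebyshev's identity *)

Lemma sum_edges {R : realType} {G : weighted_graph R}
    (g : vertex G -> vertex G -> R) :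
  \sum_(p in edges G) (g p.1 p.2 + g p.2 p.1) = \sum_x \sum_(y | adj x y) g x y.
Proof.
(* Split the ordered adjacent pairs by rank; the decreasing ones are the reversed edges. *)
have -> : \sum_x \sum_(y | adj x y) g x y =
    \sum_x \sum_(y | adj x y && (enum_rank x < enum_rank y)%N) g x y +
    \sum_x \sum_(y | adj x y && (enum_rank y < enum_rank x)%N) g x y.
  rewrite -big_split/=; apply: eq_bigr => x _.
  rewrite (bigID (fun y => (enum_rank x < enum_rank y)%N))/=; congr +%R.
  apply: eq_bigl => y; have [xy|//] := boolP (adj x y).
  rewrite -leqNgt leq_eqVlt (inj_eq val_inj) (inj_eq enum_rank_inj).
  by rewrite eq_sym (negPf (adj_neq xy)).
rewrite [X in _ = _ + X](exchange_big_dep xpredT)//= !pair_big_dep/=.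
by rewrite big_split/=; congr +%R; apply: eq_bigl => -[x y]; rewrite inE//= adj_sym.
Qed.

(** The sign of [b j - b i] makes all terms nonnegative when [a] and [b] are oppositely ordered. *)
Lemma chebyshev_sumE {R : realType} {I : finType} (P : pred I) (a b : I -> R) :
  \sum_(i | P i) \sum_(j | P j) (a i - a j) * (b j - b i) =
  2 * ((\sum_(i | P i) a i) * (\sum_(i | P i) b i)
       - #|P|%:R * \sum_(i | P i) a i * b i).
Proof.
have inner i : \sum_(j | P j) (a i - a j) * (b j - b i) =
    a i * (\sum_(j | P j) b j) - #|P|%:R * (a i * b i)
    - \sum_(j | P j) a j * b j + b i * \sum_(j | P j) a j.
  rewrite (eq_bigr (fun j => a i * b j - a i * b i - a j * b j + b i * a j));
    last by move=> j _; ring.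
  by rewrite big_split/= !sumrB sumr_const -!mulr_sumr mulr_natl.
under eq_bigr do rewrite inner.
rewrite big_split/= !sumrB -!mulr_suml -!mulr_sumr sumr_const -[_ *+ #|_|]mulr_natl.
ring.
Qed.

(** * The defect of the curvature bound at a vertex *)

Section LocalCurvature.
Context {R : realType} {G : weighted_graph R} (F : R -> R).
Hypothesis F_gt0 : forall t : R, 0 < t -> 0 < F t.
Hypothesis F_incr : forall s t : R, 0 < s -> s < t -> F s < F t.
Let w (x y : vertex G) : R := F (len x y) / len x y.

Definition vertex_defect (x : vertex G) : R :=
  2 - #|adj x|%:R - \sum_(y | adj x y) half_kappa w x y.

Lemma weight_gt0 x y : adj x y -> 0 < w x y.
Proof. by move=> /len_gt0 xy; rewrite divr_gt0 ?F_gt0. Qed.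

(** Chebyshev's identity for F(d) and 1/d: their products are the weights, with sum D_x, while w d =
    F(d) rewrites the sum in [half_kappa]. *)
Lemma vertex_defectE x y : adj x y ->
  vertex_defect x = (2 * weighted_degree w x)^-1 *
    \sum_(i | adj x i) \sum_(j | adj x j)
      (F (len x i) - F (len x j)) * ((len x j)^-1 - (len x i)^-1).
Proof.
move=> xy; have D_gt0 := weighted_degree_gt0 weight_gt0 xy.
rewrite (chebyshev_sumE _ (fun i => F (len x i)) (fun i => (len x i)^-1)).
rewrite -/(weighted_degree w x) /vertex_defect /half_kappa sumrB.
rewrite -mulr_suml -!mulr_sumr -/(weighted_degree w x).
rewrite (eq_bigr (fun z => F (len x z))); last first.
  by move=> z /len_gt0 xz; rewrite divfK ?gt_eqF.
by field; rewrite gt_eqF.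
Qed.

Lemma chebyshev_term_ge0 s t : 0 < s -> 0 < t ->
  0 <= (F s - F t) * (t^-1 - s^-1) ?= iff (s == t).
Proof.
(* Exchanging [s] and [t] flips the sign of both factors. *)
move=> s_gt0 t_gt0; wlog st : s t s_gt0 t_gt0 / s <= t => [hw|].
  case: (leP s t) => [|/ltW] st; first exact: hw.
  have := hw t s t_gt0 s_gt0 st; rewrite eq_sym.
  by rewrite -(opprB (F s)) -(opprB t^-1) mulrNN.
have [->|s_neq_t] := eqVneq s t; first by rewrite subrr mul0r; exact/leif_refl.
have s_lt_t : s < t by rewrite lt_neqAle s_neq_t.
have : 0 < (F s - F t) * (t^-1 - s^-1).
  by rewrite nmulr_rgt0 ?subr_lt0 ?F_incr// ltf_pV2.
by move=> pos; split; rewrite ?ltW// lt_eqF.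
Qed.

Lemma vertex_defect_ge0 x : 0 <= vertex_defect x.
Proof.
have [/existsP[y xy]|no_nbr] := boolP [exists y, adj x y].
  rewrite (vertex_defectE _ _ xy) mulr_ge0 ?invr_ge0 ?mulr_ge0//.
    by rewrite ltW// (weighted_degree_gt0 weight_gt0 xy).
  by do 2![apply: sumr_ge0 => ? ?]; rewrite chebyshev_term_ge0// len_gt0.
(* An isolated vertex has empty sums and defect 2. *)
have no_adj y : adj x y = false by apply/negbTE; move/existsPn: no_nbr.
by rewrite /vertex_defect eq_card0// big_pred0// !subr0.
Qed.

Lemma vertex_defect_eq0 x y : adj x y ->
  vertex_defect x = 0 <-> forall i j, adj x i -> adj x j -> len x i = len x j.
Proof.
move=> xy; rewrite (vertex_defectE _ _ xy).
have D_gt0 := weighted_degree_gt0 weight_gt0 xy.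
have term_ge0 i j : adj x i -> adj x j ->
    0 <= (F (len x i) - F (len x j)) * ((len x j)^-1 - (len x i)^-1).
  by move=> xi xj; rewrite chebyshev_term_ge0// len_gt0.
split=> [/eqP|len_cst]; last first.
  rewrite big1 ?mulr0// => i xi; rewrite big1// => j xj.
  by rewrite (len_cst i j)// subrr mul0r.
rewrite mulf_eq0 invr_eq0 mulf_eq0 pnatr_eq0/= gt_eqF//=.
rewrite psumr_eq0; last by move=> i xi; apply: sumr_ge0 => j; exact: term_ge0.
move=> /allP sum0 i j xi xj; have := sum0 i (mem_index_enum i).
rewrite xi/= psumr_eq0; last by move=> k; exact: term_ge0.
move=> /allP/(_ j (mem_index_enum j)); rewrite xj/= eq_sym.
by rewrite chebyshev_term_ge0 ?len_gt0// => /eqP.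
Qed.

Lemma bound_sub_total_curvature : treelike G ->
  2 * #|vertex G|%:R - 2 * #|edges G|%:R - total_curvature w =
  \sum_x vertex_defect x.
Proof.
move=> G_treelike; rewrite !sumrB sumr_const; congr (_ - _ - _).
- by rewrite mulr_natr.
(* The constant function 1 gives the handshake formula: the degrees sum to 2|E|. *)
- have := sum_edges (fun _ _ : vertex G => 1 : R).
  rewrite sumr_const mulr_natr => ->.
  by apply: eq_bigr => x _; rewrite sumr_const.
- rewrite -sum_edges; apply: eq_bigr => -[x y]; rewrite inE => /andP[xy _].
  exact: kappa_edge weight_gt0 _ _ xy.
Qed.

End LocalCurvature.

(** * From constancy at each vertex to global constancy *)

Lemma exists_adj {R : realType} {G : weighted_graph R} (x : vertex G) :
  (1 < #|vertex G|)%N -> exists y, adj x y.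
Proof.
rewrite (cardD1 x) inE ltnS => /card_gt0P[y]; rewrite !inE andbT => yx.
have /connectP[[|z p]] := adj_connected x y; last by move=> /= /andP[xz _] _; exists z.
by move=> _ /= yE; rewrite yE eqxx in yx.
Qed.

Lemma locally_constant_len {R : realType} {G : weighted_graph R} :
  (forall x i j : vertex G, adj x i -> adj x j -> len x i = len x j) ->
  exists c : R, forall x y : vertex G, adj x y -> len x y = c.
Proof.
move=> loc; have [[x0 [y0 xy0]]|none] := pselect (exists x y : vertex G, adj x y).
  exists (len x0 y0) => x; have /connectP[p] := adj_connected x0 x.
  (* Invariant carried along the path: all edges at the current vertex have length [c]. *)
  have : forall y, adj x0 y -> len x0 y = len x0 y0 by move=> y xy; exact: loc.
  move: (len x0 y0) => c; elim: p x0 {xy0} => [|u p IH] v v_len /=; first by move=> _ ->.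
  move=> /andP[vu up] xE; apply: (IH u) => // y uy.
  have uv : adj u v by rewrite adj_sym.
  by rewrite (loc u y v uy uv) -(len_sym vu) v_len.
by exists 0 => x y xy; case: none; exists x, y.
Qed.

Theorem theorem3p6 (R : realType) (G : weighted_graph R) (F : R -> R)
    (G_treelike : treelike G)
    (F_gt0 : forall t : R, 0 < t -> 0 < F t)
    (F_incr : forall s t : R, 0 < s -> s < t -> F s < F t) :
  let K := total_curvature (fun x y : vertex G => F (len x y) / len x y) in
  let bound := 2 * #|vertex G|%:R - 2 * #|edges G|%:R in
  K <= bound /\
  ((1 < #|vertex G|)%N ->
   (K = bound <-> exists c : R, forall x y : vertex G, adj x y -> len x y = c)).
Proof.
move=> K bound.
have defectE : bound - K = \sum_(x : vertex G) vertex_defect F x.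
  exact: bound_sub_total_curvature.
split; first by rewrite -subr_ge0 defectE sumr_ge0// => x _; exact: vertex_defect_ge0.
(* With more than one vertex, connectedness excludes isolated vertices, whose defect 2 would make
   the inequality strict. *)
move=> V_gt1; have [nbr adj_nbr] := choice (fun x => exists_adj x V_gt1).
have defect_eq0 x := vertex_defect_eq0 F F_gt0 F_incr x _ (adj_nbr x).
split=> [KE|[c len_c]].
  apply: locally_constant_len => x; apply/defect_eq0/eqP.
  have /eqP := defectE; rewrite KE subrr eq_sym psumr_eq0; last first.
    by move=> z _; exact: vertex_defect_ge0.
  by move=> /allP/(_ x (mem_index_enum x)).
apply/esym/eqP; rewrite -subr_eq0 defectE big1// => x _.
by apply/defect_eq0 => i j xi xj; rewrite !len_c.
Qed.
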